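(* If $G$ is a complete graph on $n$ vertices, then the MBRTP problem (given $G$, a root $r$, capacities $c_v\in\mathbb{Z}_{\ge 0}$ for all vertices $v$, and a positive integer $K$, find a bounded rooted-tree packing $(T_1,\dots,T_K)$, $T_k=(V_k,E_k)$, maximizing $\sum_{k=1}^K |V_k|$) can be solved in polynomial time $\mathcal O(nK)$.
   Context: A rooted tree (or $r$-tree) of $G$ is an acyclic connected subgraph $T=(V_T,E_T)$ of $G$ with $r\in V_T$; the single vertex $(\{r\},\emptyset)$ is the null $r$-tree. The tree is viewed as rooted at $r$, and $C_T(v)$ denotes the number of children of $v$ in $T$ (taken to be $0$ if $v\notin V_T$). A family $(T_1,\dots,T_K)$ of $r$-trees of $G$ is a bounded rooted-tree packing if $\sum_{k=1}^K C_{T_k}(v)\le c_v$ for all vertices $v$. *)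

(* Defs.v *)
From mathcomp Require Import all_boot.

Set Implicit Arguments.
Unset Strict Implicit.
Unset Printing Implicit Defensive.

(* A finite simple graph whose vertices are taken from [U]; an edge is an
   unordered pair, represented as a two-element set. *)
Record graph (U : finType) := Graph {
  vertices : {set U};
  edges : {set {set U}};
  edgesP : forall e, e \in edges -> (#|e| == 2) && (e \subset vertices)
}.

Section Graphs.
Variable U : finType.
Implicit Types G T : graph U.

(* Irreflexive: [set u; u] is a singleton, hence never an edge. *)
Definition adj G : rel U := fun u v => [set u; v] \in edges G.

Definition subgraph T G : Prop :=
  vertices T \subset vertices G /\ edges T \subset edges G.

(* [U] is exactly the vertex set, so the number of vertices is #|U|. *)
Definition complete_graph G : Prop :=
  vertices G = [set: U] /\ forall u v : U, u != v -> adj G u v.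

Definition connected_graph G : Prop :=
  forall u v, u \in vertices G -> v \in vertices G -> connect (adj G) u v.

(* A two-element [ucycle] only walks an edge back and forth. *)
Definition acyclic_graph G : Prop :=
  forall s : seq U, 2 < size s -> ~ ucycle (adj G) s.

Definition rtree G (r : U) T : Prop :=
  [/\ subgraph T G, r \in vertices T, connected_graph T & acyclic_graph T].

(* [w] is a child of [v] in [T] rooted at [r] when [v] immediately precedes [w]
   on a simple path r, p, w of [T].  The bound on the length of [p] only serves
   to make the relation boolean: such a path has #|p| + 2 <= #|U| vertices. *)
Definition child T (r v w : U) : bool :=
  [exists k : 'I_#|U|, [exists p : k.-tuple U,
    [&& path (adj T) r (rcons p w), uniq (r :: rcons p w) & last r p == v]]].

(* For r \in vertices T this is 0 whenever v \notin vertices T. *)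
Definition nchildren T (r v : U) : nat := #|[set w | child T r v w]|.

Definition bounded_packing G (r : U) (c : U -> nat) (K : nat)
    (T : 'I_K -> graph U) : Prop :=
  (forall k, rtree G r (T k)) /\
  (forall v, v \in vertices G -> \sum_(k < K) nchildren (T k) r v <= c v).

Definition packing_value (K : nat) (T : 'I_K -> graph U) : nat :=
  \sum_(k < K) #|vertices (T k)|.

Definition mbrtp_optimal G (r : U) (c : U -> nat) (K : nat)
    (T : 'I_K -> graph U) : Prop :=
  bounded_packing G r c T /\
  forall T' : 'I_K -> graph U,
    bounded_packing G r c T' -> packing_value T' <= packing_value T.

End Graphs.

(* Running time is measured on a random access machine over the natural numbers
   with indirect addressing, addition and truncated subtraction (and no
   multiplication), under the uniform cost criterion: every node of an evaluated
   expression and every executed assignment, store, skip or test costs 1.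
   Programs are structured, i.e. use loops in place of jumps. *)
Inductive expr :=
  | Const of nat
  | Reg of nat
  | Get of expr
  | Add of expr & expr
  | Sub of expr & expr.

Inductive cmd :=
  | Skip
  | Assign of nat & expr
  | Put of expr & expr
  | Seq of cmd & cmd
  | If of expr & cmd & cmd
  | While of expr & cmd.

Record state := State { regs : nat -> nat; mem : nat -> nat }.

Fixpoint eval (s : state) (e : expr) : nat :=
  match e with
  | Const a => a
  | Reg x => regs s x
  | Get e1 => mem s (eval s e1)
  | Add e1 e2 => eval s e1 + eval s e2
  | Sub e1 e2 => eval s e1 - eval s e2
  end.

Fixpoint cost (e : expr) : nat :=
  match e with
  | Const _ | Reg _ => 1
  | Get e1 => (cost e1).+1
  | Add e1 e2 | Sub e1 e2 => (cost e1 + cost e2).+1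
  end.

(* [exec p s t s'] : started in [s], [p] halts in [s'] after [t] steps.
   A test succeeds when its expression is nonzero. *)
Inductive exec : cmd -> state -> nat -> state -> Prop :=
  | ExecSkip s : exec Skip s 1 s
  | ExecAssign s x e :
      exec (Assign x e) s (cost e).+1
        (State [eta regs s with x |-> eval s e] (mem s))
  | ExecPut s e1 e2 :
      exec (Put e1 e2) s (cost e1 + cost e2).+1
        (State (regs s) [eta mem s with eval s e1 |-> eval s e2])
  | ExecSeq p1 p2 s s1 s2 t1 t2 :
      exec p1 s t1 s1 -> exec p2 s1 t2 s2 ->
      exec (Seq p1 p2) s (t1 + t2) s2
  | ExecIf e p1 p2 s s' t :
      exec (if eval s e != 0 then p1 else p2) s t s' ->
      exec (If e p1 p2) s (cost e + t).+1 s'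
  | ExecWhileDone e p s :
      eval s e = 0 -> exec (While e p) s (cost e).+1 s
  | ExecWhileLoop e p s s1 s2 t1 t2 :
      eval s e != 0 -> exec p s t1 s1 -> exec (While e p) s1 t2 s2 ->
      exec (While e p) s (cost e + t1 + t2).+1 s2.

(* Vertices are numbered 0, ..., n - 1.  Registers 0, 1, 2 hold n, K and the
   root, memory cell v < n holds the capacity of v, and everything else is 0.
   The edges of the graph are not supplied: a complete graph on numbered
   vertices is determined by n. *)
Definition input_state (n K : nat) (r : 'I_n) (c : 'I_n -> nat) : state :=
  State (nth 0 [:: n; K; val r])
        (fun a => if insub a is Some v then c v else 0).

(* The output format of a rooted tree is its array of parents, shifted by one
   so that 0 marks the vertices outside the tree; the root is its own parent. *)
Definition encodes_tree (n : nat) (r : 'I_n) (T : graph 'I_n)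
    (a : nat -> nat) : Prop :=
  [/\ a r = r.+1,
      forall v : 'I_n, v \notin vertices T -> a v = 0
    & forall u v : 'I_n, child T r u v -> a v = u.+1].

(* The K arrays follow one another in memory, after the n input cells. *)
Definition output_packing (n K : nat) (r : 'I_n) (T : 'I_K -> graph 'I_n)
    (s : state) : Prop :=
  forall k : 'I_K, encodes_tree r (T k) (fun a => mem s (n + k * n + a)).

(* Main.v *)
Require Import Defs.
From mathcomp Require Import all_boot.
From mathcomp Require Import zify.

Set Implicit Arguments.
Unset Strict Implicit.
Unset Printing Implicit Defensive.

(* The optimum is K + min(j (n - 1), sum of the c_v) with j = min(K, c_r): every
   nonnull tree uses a unit of capacity of the root, so there are at most j of
   them, and the number of nonroot vertices of a tree is its number of children.
   To reach this bound, one unit of the root is reserved for each of j trees,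
   which are filled in turn.  A tree first takes in, along a path, all vertices
   with capacity left, so that no capacity is out of reach; then any remaining
   capacity is spent on hanging the other vertices, until the tree is spanning
   or no capacity is left.  If a tree exhausts the capacity, then each later one
   uses exactly its reserved unit; so either the j trees are all spanning or all
   capacity is used.  Both stages are linear scans of the vertices. *)

(** * Trees given by parent maps *)

(** The rank [d] strictly drops from a vertex to its parent, so iterating [par] inside [V] ends at
    [r]. The fixed point [par r = r] matches the output format. *)
Definition parent_map (U : finType) (r : U) (V : {set U}) (par : U -> U) :=
  [/\ r \in V, par r = r
    & exists d : U -> nat, forall v, v \in V -> v != r ->
        par v \in V /\ d (par v) < d v].

(** The root is taken out because, as its own parent, it would count among its own children. *)
Definition kids (U : finType) (r : U) (V : {set U}) (par : U -> U) (u : U) :=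
  #|[set w in V :\ r | par w == u]|.

Lemma sum_kids (U : finType) (r : U) (V : {set U}) (par : U -> U) :
  r \in V -> (\sum_u kids r V par u).+1 = #|V|.
Proof.
move=> rV; rewrite (cardsD1 r V) rV add1n; congr _.+1.
apply: esym; rewrite -sum1_card (partition_big par xpredT) //=.
apply: eq_bigr => u _; rewrite sum1dep_card.
by apply: eq_card => w; rewrite !inE.
Qed.

Lemma kids_root (U : finType) (r : U) (par : U -> U) u :
  kids r [set r] par u = 0.
Proof.
by apply/eqP; rewrite cards_eq0; apply/eqP/setP=> w; rewrite !inE andNb.
Qed.

Lemma parent_map_root (U : finType) (r : U) : parent_map r [set r] id.
Proof.
split=> //; first by rewrite inE.
by exists (fun=> 0) => v; rewrite inE => ->.
Qed.

Lemma parent_map_attach (U : finType) (r : U) (V : {set U}) (par : U -> U) u v :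
  parent_map r V par -> u \in V -> v \notin V ->
  parent_map r (v |: V) [eta par with v |-> u].
Proof.
move=> [rV parr [d dP]] uV vV.
have neq_v w : w \in V -> (w == v) = false.
  by move=> wV; apply/eqP=> wv; rewrite -wv wV in vV.
split=> /=; first by rewrite !inE rV orbT.
  by rewrite neq_v.
(* The new leaf ranks just above [u]; the old ranks stay valid because parents of vertices of [V]
   lie in [V], hence differ from [v]. *)
exists [eta d with v |-> (d u).+1] => w; rewrite !inE => /predU1P[-> _|wV wr] /=.
  by rewrite eqxx neq_v // uV orbT.
have [pV dlt] := dP w wV wr.
by rewrite !neq_v // pV orbT.
Qed.

Lemma kids_attach (U : finType) (r : U) (V : {set U}) (par : U -> U) u v w :
  r \in V -> v \notin V ->
  kids r (v |: V) [eta par with v |-> u] w = kids r V par w + (w == u).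
Proof.
move=> rV vV; have vr : v != r by apply: contraNneq vV => ->.
have neq_v x : x \in V -> (x == v) = false.
  by move=> xV; apply/eqP=> xv; rewrite -xv xV in vV.
rewrite /kids (cardsD1 v) !inE eqxx vr /= eqxx eq_sym addnC; congr (_ + _).
apply: eq_card => x; rewrite !inE /=.
case xV: (x \in V); first by rewrite neq_v.
by case: (x == v); rewrite ?andbF.
Qed.

Lemma adj_sym (U : finType) (T : graph U) : symmetric (adj T).
Proof. by move=> u v; rewrite /adj setUC. Qed.

(** The edges join each nonroot vertex to its parent. Descending along ranks gives connectedness,
    and a vertex of maximal rank on a cycle would have two parents. The implication for [child]
    serves both to bound [nchildren] by [kids] and to read off the output array. *)
Lemma parent_map_graph (U : finType) (G : graph U) (r : U) (V : {set U})
    (par : U -> U) :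
  complete_graph G -> parent_map r V par ->
  exists T : graph U, [/\ rtree G r T, vertices T = V &
    forall u v, child T r u v -> [/\ v \in V, v != r & par v = u]].
Proof.
move=> [vG eG] [rV parr [d dP]].
pose E := [set [set x; par x] | x in V :\ r].
have par_neq x : x \in V -> x != r -> x != par x.
  by move=> xV xr; have [_] := dP x xV xr; apply: contraTneq => <-; rewrite ltnn.
have EP e : e \in E -> (#|e| == 2) && (e \subset V).
  case/imsetP=> x /setD1P[xr xV] ->; have [pV _] := dP x xV xr.
  by rewrite cards2 par_neq //= subUset !sub1set xV.
pose T := Graph EP.
have adjT u v : adj T u v ->
    [/\ u \in V, u != r & par u = v] \/ [/\ v \in V, v != r & par v = u].
  move=> uvE; have uv : u != v.
    by have /andP[+ _] := EP _ uvE; rewrite cards2; case: (u != v).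
  case/imsetP: uvE => x /setD1P[xr xV] E2.
  have : x \in [set u; v] by rewrite E2 set21.
  have : u \in [set x; par x] by rewrite -E2 set21.
  have : v \in [set x; par x] by rewrite -E2 set22.
  rewrite !inE => vx ux /orP[/eqP xu|/eqP xv]; subst x.
    by left; split=> //; move: vx; rewrite eq_sym (negPf uv) /= => /eqP.
  by right; split=> //; move: ux; rewrite (negPf uv) /= => /eqP.
have conn v : v \in V -> connect (adj T) r v.
  have [m] := ubnP (d v); elim: m v => // m IHm v dv vV.
  have [->//|vr] := eqVneq v r; have [pV dlt] := dP v vV vr.
  apply: connect_trans (IHm (par v) _ pV) (connect1 _); first lia.
  by rewrite adj_sym; apply/imsetP; exists v; rewrite // !inE vr.
exists T; split=> //.
  split=> //.
  - split; first by rewrite vG subsetT.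
    apply/subsetP=> e /imsetP[x /setD1P[xr xV] ->].
    exact: eG (par_neq x xV xr).
  - move=> u v uV vV; apply: connect_trans (conn v vV).
    by rewrite (sym_connect_sym (@adj_sym _ T)) conn.
  - move=> s s_gt2 s_cyc.
    have [x0 x0s] : exists x0, x0 \in s.
      by case: s s_gt2 {s_cyc} => // x0 s; exists x0; rewrite mem_head.
    have [x xs xmax] := arg_maxnP d x0s.
    have {s_cyc} := s_cyc; case: (rot_to xs) => i p rot_s.
    rewrite -(rot_ucycle i) rot_s.
    have: size (x :: p) = size s by rewrite -rot_s size_rot.
    have sub_s y : y \in x :: p -> y \in s by rewrite -rot_s mem_rot.
    case: p sub_s {rot_s} => [|y [|z p]] sub_s /=; try lia.
    move=> _ /andP[/= /andP[xy /andP[_ cyc]] uniq_s].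
    move: cyc; rewrite rcons_path => /andP[_ lx].
    set l := last z p in lx.
    have ls : l \in z :: p by rewrite mem_last.
    (* An edge from [x] to a child would reach a rank above the maximum on [s]; so both neighbours
       of [x] on the cycle are its parent, against uniqueness. *)
    have top w : w \in s -> adj T x w -> par x = w.
      move=> ws /adjT[[]//|[wV wr pw]].
      by have [_] := dP w wV wr; rewrite pw ltnNge (xmax w ws : d w <= d x).
    have px1 : par x = y.
      by apply: top => //; apply: sub_s; rewrite !inE eqxx orbT.
    have px2 : par x = l.
      apply: top; rewrite 1?adj_sym //; apply: sub_s.
      by rewrite 2!in_cons ls !orbT.
    case/and3P: uniq_s => _ /negP + _; apply.
    by rewrite -px1 px2.
(* On a simple path from the root, the parent of the current vertex lies behind, so the next edge
   can only lead to a child. The disjunct [x = r] starts the induction. *)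
have key (p : seq U) (x w : U) : x = r \/ par x \notin rcons p w ->
    path (adj T) x (rcons p w) -> uniq (x :: rcons p w) -> r \notin rcons p w ->
    [/\ w \in V, w != r & par w = last x p].
  elim: p x => [|y p IHp] x /= hx.
    rewrite !inE => /andP[/adjT[[_ xr px]|//] _] _ _.
    by case: hx => [xr'|]; [rewrite xr' eqxx in xr|rewrite px !inE eqxx].
  case/andP=> /adjT xy py /andP[xnot uniq_y].
  rewrite in_cons negb_or => /andP[ry rp].
  have {}xy : par y = x.
    case: xy => [[_ xr px]|[]//].
    by case: hx => [xr'|]; [rewrite xr' eqxx in xr|rewrite px in_cons eqxx].
  apply: IHp => //; right; rewrite xy.
  by move: xnot; rewrite in_cons negb_or => /andP[].
move=> u v /existsP[k /existsP[p /and3P[pp up /eqP <-]]].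
apply: key => //; first by left.
by case/andP: up.
Qed.

(** * Upper bound on the value of a packing *)

(** Shortening a walk from [r] to [w] to a simple path gives both claims: its last edge exhibits a
    parent of [w], its first edge a child of [r]. *)
Lemma rtree_child (U : finType) (G : graph U) (r : U) T w :
  rtree G r T -> w \in vertices T -> w != r ->
  (exists u, child T r u w) /\ 0 < nchildren T r r.
Proof.
move=> [_ rT connT _] wT wr.
have childI p v : path (adj T) r (rcons p v) -> uniq (r :: rcons p v) ->
    child T r (last r p) v.
  move=> pp up; have := max_card (mem (r :: rcons p v)).
  rewrite (card_uniqP up) /= size_rcons => sp.
  have sp' : size p < #|U| := ltnW sp.
  apply/existsP; exists (Ordinal sp'); apply/existsP; exists (in_tuple p).
  exact/and3P.
have /connectP[p0 p0p w_last] := connT r w rT wT.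
case/shortenP: p0p w_last => p pp up _ w_last; split.
  case/lastP: p pp up w_last => [|q z] pp up; first by move/eqP; rewrite (negPf wr).
  by rewrite last_rcons => zw; rewrite zw; exists (last r q); apply: childI.
case: p pp up w_last => [|y p] pp up; first by move/eqP; rewrite (negPf wr).
move=> _; rewrite card_gt0; apply/set0Pn; exists y; rewrite inE.
apply: (childI [::] y) => /=; first by case/andP: pp => ->.
by move: up; rewrite /= !inE; case: (r == y).
Qed.

(** Double counting of the pairs of a vertex and its child: each nonroot vertex is the child in at
    least one pair. *)
Lemma rtree_card_children (U : finType) (G : graph U) (r : U) T :
  rtree G r T -> #|vertices T| <= (\sum_u nchildren T r u).+1.
Proof.
move=> rtT; have [_ rT _ _] := rtT.
rewrite (cardsD1 r) rT add1n ltnS -sum1_card.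
under [X in _ <= X]eq_bigr => u _ do rewrite /nchildren -sum1dep_card big_mkcond.
rewrite exchange_big /= [X in X <= _]big_mkcond /=; apply: leq_sum => w _.
case: ifP => // /setD1P[wr wT].
have [[u cu] _] := rtree_child rtT wT wr.
by rewrite (bigD1 u) //= cu.
Qed.

(** The factor [minn 1 _] indicates a nonnull tree: if the root has no child, the tree is the root
    alone. *)
Lemma rtree_card_root (U : finType) (G : graph U) (r : U) T :
  rtree G r T -> #|vertices T| <= (minn 1 (nchildren T r r) * #|U|.-1).+1.
Proof.
move=> rtT; have [_ rT _ _] := rtT.
have [/eqP c0|c_gt0] := posnP (nchildren T r r); last first.
  rewrite (minn_idPl c_gt0) mul1n; apply: leq_trans (leqSpred _).
  exact: max_card (mem (vertices T)).
rewrite (eqP c0) minn0 mul0n -(cards1 r) subset_leq_card //.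
apply/subsetP=> w wT; rewrite inE; apply: contraT => wr.
by have [_] := rtree_child rtT wT wr; rewrite (eqP c0).
Qed.

Lemma packing_value_le (U : finType) (G : graph U) (r : U) c K
    (T : 'I_K -> graph U) :
  complete_graph G -> bounded_packing G r c T ->
  packing_value T <= K + minn (minn (c r) K * #|U|.-1) (\sum_v c v).
Proof.
move=> [vG _] [rtT capT]; rewrite /packing_value.
have capT' v : \sum_(k < K) nchildren (T k) r v <= c v.
  by apply: capT; rewrite vG.
rewrite addn_minr leq_min; apply/andP; split.
  apply: (@leq_trans (\sum_(k < K) (1 + minn 1 (nchildren (T k) r r) * #|U|.-1))).
    by apply: leq_sum => k _; rewrite add1n (rtree_card_root (rtT k)).
  rewrite big_split /= sum1_card card_ord leq_add2l -big_distrl /=.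
  (* The indicators sum to at most the number of children of the root over all trees, hence to at
     most [c r], and also to at most [K]. *)
  rewrite leq_mul2r leq_min; apply/orP; right; apply/andP; split.
    by apply: leq_trans (capT' r); apply: leq_sum => k _; apply: geq_minr.
  rewrite -[X in _ <= X](card_ord K) -sum1_card.
  by apply: leq_sum => k _; apply: geq_minl.
apply: (@leq_trans (\sum_(k < K) (1 + \sum_v nchildren (T k) r v))).
  by apply: leq_sum => k _; rewrite add1n (rtree_card_children (rtT k)).
rewrite big_split /= sum1_card card_ord leq_add2l exchange_big /=.
exact: leq_sum.
Qed.

(** * Weakest preconditions with running times *)

(* [all_boot] hides the memory projection [mem]. *)
Import Defs.

(** Total correctness: a halting run must exist, and [Q] also sees its number of steps. *)
Definition wp (p : cmd) (Q : nat -> state -> Prop) (s : state) :=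
  exists t s', exec p s t s' /\ Q t s'.

Lemma wp_mono p (Q Q' : nat -> state -> Prop) (s : state) :
  (forall t s', Q t s' -> Q' t s') -> wp p Q s -> wp p Q' s.
Proof. by move=> QQ' [t [s' [ps /QQ' Qs]]]; exists t, s'. Qed.

Lemma wp_skip (Q : nat -> state -> Prop) (s : state) : Q 1 s -> wp Skip Q s.
Proof. by move=> Qs; exists 1, s; split=> //; constructor. Qed.

Lemma wp_assign (x : nat) e (Q : nat -> state -> Prop) (s : state) :
  Q (cost e).+1 (State [eta regs s with x |-> eval s e] (mem s)) ->
  wp (Assign x e) Q s.
Proof. by move=> Qs; do 2!eexists; split; [constructor|exact: Qs]. Qed.

Lemma wp_put e1 e2 (Q : nat -> state -> Prop) (s : state) :
  Q (cost e1 + cost e2).+1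
    (State (regs s) [eta mem s with eval s e1 |-> eval s e2]) ->
  wp (Put e1 e2) Q s.
Proof. by move=> Qs; do 2!eexists; split; [constructor|exact: Qs]. Qed.

Lemma wp_seq p1 p2 (Q : nat -> state -> Prop) (s : state) :
  wp p1 (fun t1 => wp p2 (fun t2 => Q (t1 + t2))) s -> wp (Seq p1 p2) Q s.
Proof.
move=> [t1 [s1 [ps1 [t2 [s2 [ps2 Qs]]]]]].
by exists (t1 + t2), s2; split=> //; apply: ExecSeq ps1 ps2.
Qed.

Lemma wp_if e p1 p2 (Q : nat -> state -> Prop) (s : state) :
  wp (if eval s e != 0 then p1 else p2) (fun t => Q (cost e + t).+1) s ->
  wp (If e p1 p2) Q s.
Proof.
move=> [t [s' [ps Qs]]]; exists (cost e + t).+1, s'; split=> //.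
exact: ExecIf.
Qed.

(** Each iteration consumes at least one unit of the measure [m] and costs at most one test plus
    [b]; the final summand pays for the failing test. *)
Lemma wp_while e p (I : state -> Prop) (m : state -> nat) b
    (Q : nat -> state -> Prop) (s : state) :
  I s ->
  (forall s, I s -> eval s e != 0 ->
     wp p (fun t s' => [/\ t <= b, I s' & m s' < m s]) s) ->
  (forall t s', t <= m s * (cost e + b).+1 + (cost e).+1 ->
     I s' -> eval s' e = 0 -> Q t s') ->
  wp (While e p) Q s.
Proof.
move=> + body; have [k] := ubnP (m s); elim: k s Q => // k IHk s Q ms Is HQ.
have [e0|e1] := eqVneq (eval s e) 0.
  exists (cost e).+1, s; split; first exact: ExecWhileDone.
  by apply: HQ => //; apply: leq_addl.
have [t1 [s1 [ps1 [t1b Is1 ms1]]]] := body s Is e1.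
have [||t2 [s2 [ps2 [t2b Is2 e2]]]] := IHk s1 (fun t s' =>
  [/\ t <= m s1 * (cost e + b).+1 + (cost e).+1, I s' & eval s' e = 0]) _ Is1.
- exact: leq_trans ms1 _.
- by [].
exists (cost e + t1 + t2).+1, s2; split; first exact: ExecWhileLoop ps1 ps2.
apply: HQ => //; have : (m s1).+1 * (cost e + b).+1 <= m s * (cost e + b).+1.
  by rewrite leq_mul2r ms1 orbT.
rewrite mulSn; lia.
Qed.

(** * The packing program *)

(* Registers: 0, 1, 2 hold n, the number of trees still to be output and the
   root; 3 holds the number of nonnull trees still to be output, 4 the address
   of the array of the current tree, 5 and 6 a vertex and its parent-to-be. *)
Definition attach : cmd :=
  Seq (Put (Add (Reg 4) (Reg 5)) (Add (Reg 6) (Const 1)))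
      (Put (Reg 6) (Sub (Get (Reg 6)) (Const 1))).

Definition incr x : cmd := Assign x (Add (Reg x) (Const 1)).
Definition decr x : cmd := Assign x (Sub (Reg x) (Const 1)).

(** Register 6 is the end of the path. If it has capacity at the start, it always has: once it has
    paid for a child it is replaced by that child, which was chosen with positive capacity. *)
Definition chain : cmd :=
  While (Sub (Reg 0) (Reg 5))
    (Seq (If (Get (Add (Reg 4) (Reg 5))) Skip
           (If (Get (Reg 5)) (Seq attach (Assign 6 (Reg 5))) Skip))
      (incr 5)).

(* The test is the minimum of n - v and n - u. *)
Definition hang : cmd :=
  While (Sub (Sub (Reg 0) (Reg 5))
             (Sub (Sub (Reg 0) (Reg 5)) (Sub (Reg 0) (Reg 6))))
    (If (Get (Reg 6))
      (Seq (If (Get (Add (Reg 4) (Reg 5))) Skip attach) (incr 5))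
      (incr 6)).

Definition grow : cmd :=
  Seq (Assign 5 (Const 0)) (Seq (Assign 6 (Reg 2)) (Seq chain
  (Seq (Assign 5 (Const 0)) (Seq (Assign 6 (Const 0)) hang)))).

(** The null tree is written first. If a unit of the root is still reserved, it is released to the
    root's capacity just before the tree grows. *)
Definition next_tree : cmd :=
  Seq (Put (Add (Reg 4) (Reg 2)) (Add (Reg 2) (Const 1)))
  (Seq (If (Reg 3)
         (Seq (decr 3) (Seq (Put (Reg 2) (Add (Get (Reg 2)) (Const 1))) grow))
         Skip)
  (Seq (Assign 4 (Add (Reg 4) (Reg 0))) (decr 1))).

(** With truncated subtraction, [a - (a - b)] is the minimum of [a] and [b]: register 3 receives the
    number of units to reserve, which are then withheld from the root. *)
Definition pack : cmd :=
  Seq (Assign 3 (Sub (Get (Reg 2)) (Sub (Get (Reg 2)) (Reg 1))))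
  (Seq (Put (Reg 2) (Sub (Get (Reg 2)) (Reg 3)))
  (Seq (Assign 4 (Reg 0)) (While (Reg 1) next_tree))).

(** * Growing a single tree *)

Definition parent_code (n : nat) (V : {set 'I_n}) (par : 'I_n -> 'I_n) v :=
  if v \in V then (par v).+1 else 0.

(** Invariant of both scans, relative to the state [s0] at the start of the growth. Registers 5 and
    6 are left free for the scans. *)
Record growing n (r : 'I_n) (s0 s : state) V par : Prop := Growing {
  growing_regs : forall x, x < 5 -> regs s x = regs s0 x;
  growing_map : parent_map r V par;
  growing_out : forall v : 'I_n, mem s (regs s0 4 + v) = parent_code V par v;
  growing_cap : forall v : 'I_n, mem s v + kids r V par v = mem s0 v;
  growing_frame : forall x, n <= x -> ~~ (regs s0 4 <= x < regs s0 4 + n) ->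
    mem s x = mem s0 x
}.

Lemma growing_eq n (r : 'I_n) s0 s s' V par :
  growing r s0 s V par -> mem s' = mem s ->
  (forall x, x < 5 -> regs s' x = regs s x) -> growing r s0 s' V par.
Proof.
move=> [gR gM gO gC gF] sM sR; split; rewrite ?sM // => x x5.
by rewrite sR // gR.
Qed.

(** The array of the tree starts at or after [n], so the two stores, of cost 7 and 6, hit an output
    cell and a capacity without interfering. *)
Lemma wp_attach n (r : 'I_n) s0 s V par (u v : 'I_n) :
  growing r s0 s V par -> n <= regs s0 4 ->
  regs s 5 = v -> regs s 6 = u -> u \in V -> v \notin V -> 0 < mem s u ->
  wp attach (fun t s' => [/\ t = 13, regs s' = regs s,
    growing r s0 s' (v |: V) [eta par with v |-> u] &
    forall w : 'I_n, mem s' w = mem s w - (w == u)]) s.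
Proof.
move=> [gR gM gO gC gF] nB s5 s6 uV vV cu.
apply/wp_seq/wp_put/wp_put; rewrite /= s5 s6 (gR 4) //.
have cap (w : 'I_n) : (w == regs s0 4 + v :> nat) = false.
  by have := ltn_ord w; lia.
have memE (w : 'I_n) :
    (if w == u :> nat then
       (if u == regs s0 4 + v :> nat then u + 1 else mem s u) - 1
     else if w == regs s0 4 + v :> nat then u + 1 else mem s w) =
    mem s w - (w == u).
  rewrite !cap; case: eqP => [/val_inj ->|neq_wu]; first by rewrite eqxx.
  by case: eqP => [wu|_]; [rewrite wu in neq_wu|rewrite subn0].
split=> //; split=> //=.
- exact: parent_map_attach.
- move=> w.
  have -> : (regs s0 4 + w == u) = false by have := ltn_ord u; lia.
  rewrite eqn_add2l /parent_code !inE.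
  have -> : (w == v :> nat) = (w == v) by [].
  by rewrite /=; case: eqP => _ /=; [rewrite addn1|exact: gO].
- move=> w; rewrite memE kids_attach //; last by case: gM.
  by rewrite -(gC w); case: eqP => [->|]; lia.
- move=> x nx xB; have -> : (x == u) = false by have := ltn_ord u; lia.
  by case: eqP => [xv|_]; [have := ltn_ord v; lia|apply: gF].
Qed.

(* The vertices of positive capacity are strung on a path from the root: each
   loses a unit only once it is in the tree, so none is left outside. *)
Lemma wp_chain n (r : 'I_n) s0 s V par :
  growing r s0 s V par -> n <= regs s0 4 -> regs s0 0 = n ->
  regs s 5 = 0 -> regs s 6 = r -> 0 < mem s r ->
  wp chain (fun t s' => t <= 40 * n + 4 /\ exists V par,
    growing r s0 s' V par /\ forall v : 'I_n, 0 < mem s' v -> v \in V) s.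
Proof.
move=> gs nB s00 s5 s6 cr.
pose I (s : state) := exists V par (u : 'I_n), [/\ growing r s0 s V par,
  regs s 6 = u /\ u \in V, 0 < mem s u, regs s 5 <= n &
  forall v : 'I_n, v < regs s 5 -> 0 < mem s v -> v \in V].
(* The test costs 3, so the generous body bound 36 makes 40 per iteration. *)
apply: (@wp_while _ _ I (fun s : state => n - regs s 5) 36).
- exists V, par, r; split; rewrite ?s5 //; split=> //.
  by have [] := growing_map gs.
- move=> {gs s5 s6 cr V par}s [V [par [u [gs [s6 uV] cu s5 done_lt]]]] /=.
  rewrite (growing_regs gs) // s00 => guard.
  have v_lt : regs s 5 < n by lia.
  pose v := Ordinal v_lt; have vE : regs s 5 = v by [].
  (* Capacities only drop and the tree only grows, so advancing the scan leaves just the vertex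
     scanned last to check. *)
  have next_v (V' : {set 'I_n}) (s' : state) : V \subset V' ->
      (forall w : 'I_n, mem s' w <= mem s w) -> (0 < mem s' v -> v \in V') ->
      forall w : 'I_n, w < regs s 5 + 1 -> 0 < mem s' w -> w \in V'.
    move=> sVV' le_mem vV' w; rewrite addn1 ltnS leq_eqVlt => /orP[/eqP wv|w_lt].
      by have -> : w = v by apply: val_inj.
    move=> cw; apply: (subsetP sVV'); apply: done_lt => //.
    exact: leq_trans (le_mem w).
  apply/wp_seq/wp_if; rewrite /= (growing_regs gs) // vE (growing_out gs).
  rewrite /parent_code; case: (boolP (v \in V)) => vV /=.
    apply/wp_skip/wp_assign; split=> /=; try lia.
    exists V, par, u; split=> //=; try lia.
    - by apply: growing_eq gs _ _ => //; do 5?case.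
    - exact: (next_v V s).
  apply/wp_if => /=; rewrite vE; case: ifPn => cv; last first.
    apply/wp_skip/wp_assign; split=> /=; try lia.
    exists V, par, u; split=> //=; try lia.
    - by apply: growing_eq gs _ _ => //; do 5?case.
    - by apply: (next_v V s) => //; move: cv; rewrite negbK => /eqP ->.
  apply: wp_seq; apply: wp_mono (wp_attach gs nB vE s6 uV vV cu).
  move=> _ s1 [-> sR gs1 sM]; apply/wp_assign/wp_assign.
  split=> /=; rewrite ?sR; try lia.
  exists (v |: V), [eta par with v |-> u], v; split=> //=.
  - by apply: growing_eq gs1 _ _ => //; rewrite ?sR; do 5?case.
  - by rewrite vE setU11.
  - rewrite (sM v); have -> : (v == u) = false by apply: contraNF vV => /eqP ->.
    by rewrite subn0 lt0n.
  - lia.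
  - apply: (next_v _ s1); first exact: subsetUr.
      by move=> w; rewrite sM leq_subr.
    by rewrite setU11.
- move=> t s' /= tb [V' [par' [u [gs' _ _ s5' H]]]];
  rewrite (growing_regs gs') // s00 => e0.
  split; first by move: tb; rewrite s5; lia.
  exists V', par'; split=> // v; apply: H; have := ltn_ord v; lia.
Qed.

(** All capacity lies inside the tree, so any vertex that has some can be a parent. Each round
    advances one of two scans: the end of the scan of vertices to hang means a spanning tree, the
    end of the scan of parents means exhausted capacity. *)
Lemma wp_hang n (r : 'I_n) s0 s V par :
  growing r s0 s V par -> n <= regs s0 4 -> regs s0 0 = n ->
  regs s 5 = 0 -> regs s 6 = 0 ->
  (forall v : 'I_n, 0 < mem s v -> v \in V) ->
  wp hang (fun t s' => t <= 100 * n + 20 /\ exists V par,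
    growing r s0 s' V par /\
    (V = [set: 'I_n] \/ forall v : 'I_n, mem s' v = 0)) s.
Proof.
move=> gs nB s00 s5 s6 capV.
pose I (s : state) := exists V par, [/\ growing r s0 s V par,
  regs s 5 <= n /\ regs s 6 <= n,
  forall v : 'I_n, 0 < mem s v -> v \in V,
  forall v : 'I_n, v < regs s 5 -> v \in V &
  forall v : 'I_n, v < regs s 6 -> mem s v = 0].
(* At most [2 * n] rounds, each of cost at most 48 since the test costs 11. *)
apply: (@wp_while _ _ I (fun s : state => (n - regs s 5) + (n - regs s 6)) 36).
- by exists V, par; split; rewrite ?s5 ?s6.
- move=> {gs s5 s6 capV V par}s [V [par [gs [s5 s6] capV doneV doneC]]] /=.
  rewrite (growing_regs gs) // s00 => guard.
  have v_lt : regs s 5 < n by lia.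
  have u_lt : regs s 6 < n by lia.
  pose v := Ordinal v_lt; have vE : regs s 5 = v by [].
  pose u := Ordinal u_lt; have uE : regs s 6 = u by [].
  apply/wp_if; rewrite /= {1}uE; case: ifPn => cu; last first.
    apply/wp_assign; split=> /=; try lia.
    exists V, par; split=> //=; try lia.
    - by apply: growing_eq gs _ _ => //; do 5?case.
    - move=> w; rewrite addn1 ltnS leq_eqVlt => /orP[/eqP wu|]; last exact: doneC.
      by move: cu; rewrite negbK -uE -wu => /eqP.
  have uV : u \in V by apply: capV; rewrite lt0n.
  apply/wp_seq/wp_if; rewrite /= (growing_regs gs) // {1}vE (growing_out gs).
  rewrite /parent_code; case: (boolP (v \in V)) => [vV|vV] /=.
    apply/wp_skip/wp_assign; split=> /=; try lia.
    exists V, par; split=> //=; try lia.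
    - by apply: growing_eq gs _ _ => //; do 5?case.
    - move=> w; rewrite addn1 ltnS leq_eqVlt => /orP[/eqP wv|]; last exact: doneV.
      by have -> : w = v by apply: val_inj.
  have cu' : 0 < mem s u by rewrite lt0n.
  apply: wp_mono (wp_attach gs nB vE uE uV vV cu').
  move=> _ s1 [-> sR gs1 sM]; apply/wp_assign.
  split=> /=; rewrite ?sR; try lia.
  exists (v |: V), [eta par with v |-> u]; split=> //=.
  - by apply: growing_eq gs1 _ _ => //; rewrite ?sR; do 5?case.
  - lia.
  - move=> w; rewrite sM => cw; rewrite in_setU capV ?orbT //; lia.
  - move=> w; rewrite addn1 ltnS leq_eqVlt => /orP[/eqP wv|].
      by have -> : w = v by [apply: val_inj]; rewrite setU11.
    by move=> /doneV wV; rewrite in_setU wV orbT.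
  - by move=> w; move=> /doneC; rewrite sM => ->.
- move=> t s' /= tb [V' [par' [gs' [s5' s6'] _ HV HC]]].
  rewrite (growing_regs gs') // s00 => e0.
  split; first by move: tb; rewrite s5 s6; lia.
  exists V', par'; split=> //.
  have [s5n|s6n] : regs s' 5 = n \/ regs s' 6 = n by lia.
    by left; apply/setP=> v; rewrite inE HV // s5n.
  by right=> v; apply: HC; rewrite s6n.
Qed.

Lemma wp_grow n (r : 'I_n) (s : state) :
  n <= regs s 4 -> regs s 0 = n -> regs s 2 = r -> 0 < mem s r ->
  (forall v : 'I_n, mem s (regs s 4 + v) = parent_code [set r] id v) ->
  wp grow (fun t s' => t <= 140 * n + 40 /\ exists V par,
    growing r s s' V par /\
    (V = [set: 'I_n] \/ forall v : 'I_n, mem s' v = 0)) s.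
Proof.
move=> nB s0 s2 cr out0; apply/wp_seq/wp_assign/wp_seq/wp_assign/wp_seq => /=.
set s1 := State _ _.
have gs1 : growing r s s1 [set r] id.
  split=> //=; first by case=> [|[|[|[|[|]]]]].
    exact: parent_map_root.
  by move=> v; rewrite kids_root addn0.
apply: wp_mono (wp_chain gs1 nB s0 erefl s2 cr).
move=> t1 s2' [t1b [V [par [gs2 capV]]]].
apply/wp_seq/wp_assign/wp_seq/wp_assign => /=; set s3 := State _ _.
have gs3 : growing r s s3 V par.
  by apply: growing_eq gs2 _ _ => //; do 5?case.
apply: wp_mono (wp_hang gs3 nB s0 erefl erefl capV).
move=> t2 s4 [t2b H]; split=> //; lia.
Qed.

(** * The invariant over the sequence of trees *)

(* The capacities in memory do not count the [regs s 3] units of the root that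
   are reserved for the nonnull trees still to come.  By [packed_max], as long
   as some unreserved capacity is left, all nonnull trees so far
   are spanning. *)
Record packed n (r : 'I_n) (c : 'I_n -> nat) K k (s : state)
    (V : nat -> {set 'I_n}) (par : nat -> 'I_n -> 'I_n) : Prop := Packed {
  packed_regs : [/\ regs s 0 = n, regs s 1 + k = K, regs s 2 = r,
                    regs s 3 <= regs s 1 & regs s 4 = n + k * n];
  packed_map : forall i, i < k -> parent_map r (V i) (par i);
  packed_out : forall i (v : 'I_n), i < k ->
    mem s (n + i * n + v) = parent_code (V i) (par i) v;
  packed_cap : forall v : 'I_n,
    mem s v + (v == r) * regs s 3 + \sum_(i < k) kids r (V i) (par i) v = c v;
  packed_free : forall x, n + k * n <= x -> mem s x = 0;
  packed_max : [\/ n <= 1,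
    \sum_(i < k) #|V i|.-1 + regs s 3 * n.-1 = minn (c r) K * n.-1 |
    forall v : 'I_n, mem s v = 0]
}.

(** The equation in the last hypothesis covers both a spanning tree, which takes up one reserved
    unit, and a null tree when no unit is reserved; its alternative is exhausted capacity. *)
Lemma packed_next n (r : 'I_n) c K k s V par (s' : state) V' par' :
  packed r c K k s V par ->
  [/\ regs s' 0 = n, (regs s' 1).+1 = regs s 1, regs s' 2 = r,
      regs s' 3 <= regs s' 1 & regs s' 4 = n + k.+1 * n] ->
  parent_map r V' par' ->
  (forall v : 'I_n, mem s' (n + k * n + v) = parent_code V' par' v) ->
  (forall v : 'I_n, mem s' v + (v == r) * regs s' 3 + kids r V' par' v =
     mem s v + (v == r) * regs s 3) ->
  (forall x, n <= x -> ~~ (n + k * n <= x < n + k * n + n) ->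
     mem s' x = mem s x) ->
  regs s' 3 <= regs s 3 ->
  #|V'|.-1 + regs s' 3 * n.-1 = regs s 3 * n.-1 \/
    (forall v : 'I_n, mem s' v = 0) ->
  packed r c K k.+1 s' [eta V with k |-> V'] [eta par with k |-> par'].
Proof.
move=> [sR sM sO sC sF sX] sR' mV' out' cap' frame' le3 max'.
have neq_k i : i < k -> (i == k) = false by move=> ik; rewrite ltn_eqF.
have sum_next (F : {set 'I_n} -> ('I_n -> 'I_n) -> nat) :
    \sum_(i < k.+1) F ([eta V with k |-> V'] i) ([eta par with k |-> par'] i) =
    \sum_(i < k) F (V i) (par i) + F V' par'.
  rewrite big_ord_recr /= eqxx; congr (_ + _).
  by apply: eq_bigr => i _; rewrite neq_k.
split.
- by case: sR sR' => _ <- _ _ _ [? <-]; split=> //; rewrite addnS.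
- move=> i; rewrite ltnS leq_eqVlt => /predU1P[->|ik] /=; first by rewrite eqxx.
  by rewrite neq_k //; apply: sM.
- move=> i v; rewrite ltnS leq_eqVlt => /predU1P[->|ik] /=; first by rewrite eqxx.
  have : i.+1 * n <= k * n by rewrite leq_mul2r ik orbT.
  rewrite mulSn neq_k // => ikn; have := ltn_ord v => vn.
  by rewrite frame' ?sO //; lia.
- move=> v; rewrite (sum_next (fun W p => kids r W p v)) -(sC v).
  by have := cap' v; lia.
- move=> x; rewrite mulSn => xk; rewrite frame' ?sF //; lia.
- have [n1|n1] := leqP n 1; first by apply: Or31.
  rewrite (sum_next (fun W _ => #|W|.-1)).
  case: max' => [max'|]; last by apply: Or33.
  case: sX => [|sX|mem0]; first by rewrite leqNgt n1.
    by apply: Or32; rewrite -sX -max' addnA.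
  (* Only reserved units were left before this tree. It spends [n.-1] units for each one released,
     hence at least as many as were released, so no capacity remains. *)
  apply: Or33.
  have : \sum_v (mem s' (v : 'I_n) + (v == r) * regs s' 3 + kids r V' par' v) =
      \sum_v (mem s (v : 'I_n) + (v == r) * regs s 3).
    by apply: eq_bigr => v _; apply: cap'.
  have sum_r a : \sum_(v : 'I_n) (v == r) * a = a.
    rewrite (bigD1 r) //= eqxx mul1n big1 ?addn0 // => v.
    by case: eqP.
  rewrite !big_split /= !sum_r [X in _ = X + _]big1 // add0n.
  have [rV' _ _] := mV'; have := sum_kids par' rV'.
  set S := \sum_v kids _ _ _ _ => SE eq3; rewrite -SE /= in max'.
  have leS : regs s 3 - regs s' 3 <= S.
    have -> : S = (regs s 3 - regs s' 3) * n.-1 by rewrite mulnBl -max' addnK.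
    by apply: leq_pmulr; case: (n) n1 => [|[]].
  have sum0 : \sum_(v : 'I_n) mem s' v = 0.
    by apply/eqP; rewrite -leqn0 -(leq_add2r (regs s' 3 + S)) addnA eq3; lia.
  by move=> v; move/eqP: sum0; rewrite sum_nat_eq0 => /forallP/(_ v)/eqP.
Qed.

Lemma wp_next_tree n (r : 'I_n) c K k s V par :
  packed r c K k s V par -> 0 < regs s 1 ->
  wp next_tree (fun t s' => [/\ t <= 300 * n,
    exists k V par, packed r c K k s' V par & regs s' 1 < regs s 1]) s.
Proof.
move=> Ps K_gt0; have [s0 s1k s2 s31 s4] := packed_regs Ps.
have free := packed_free Ps.
(* The root witnesses [0 < n], which lets [300 * n] absorb the constant costs. *)
have r_lt := ltn_ord r.
apply/wp_seq/wp_put; set s1 := State _ _.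
(* Memory is still zero from the current array on, so storing the code of the root alone yields the
   null tree. *)
have s1_out (v : 'I_n) : mem s1 (n + k * n + v) = parent_code [set r] id v.
  rewrite /= s2 s4 /parent_code inE eqn_add2l.
  have -> : (v == r :> nat) = (v == r) by [].
  by case: eqP => [->|_]; rewrite ?addn1 // free // leq_addr.
have s1_cap (v : 'I_n) : mem s1 v = mem s v.
  rewrite /= s2 s4; have -> // : (v == n + k * n + r :> nat) = false.
  by have := ltn_ord v; lia.
have s1_frame x : ~~ (n + k * n <= x < n + k * n + n) -> mem s1 x = mem s x.
  by rewrite /= s2 s4; case: eqP => // ->; lia.
have s1_regs : regs s1 = regs s by [].
move: s1 s1_out s1_cap s1_frame s1_regs => s1 s1_out s1_cap s1_frame s1_regs.
apply/wp_seq/wp_if; rewrite /= s1_regs.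
case: ifPn => [s3|/negPn/eqP s3]; last first.
  apply/wp_skip/wp_seq/wp_assign/wp_assign => /=;
    rewrite ?s1_regs; split; try lia.
  do 3!eexists; apply: (packed_next Ps (V' := [set r]) (par' := id)) => //=;
    rewrite ?s1_regs //.
  - by rewrite s0 s2 s4 s3 mulSn; split=> //; lia.
  - exact: parent_map_root.
  - by move=> v; rewrite kids_root addn0 (s1_cap v).
  - by move=> x nx; apply: s1_frame.
  - by left; rewrite cards1.
apply/wp_seq/wp_assign/wp_seq/wp_put.
set st := State _ _.
have st_out (v : 'I_n) : mem st (regs st 4 + v) = parent_code [set r] id v.
  rewrite -s1_out /= s1_regs s4 s2.
  by have -> // : (n + k * n + v == r) = false by lia.
have st_cap (v : 'I_n) : mem st v = mem s v + (v == r).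
  rewrite -(s1_cap v) /= s1_regs s2; have -> : (v == r :> nat) = (v == r) by [].
  by case: eqP => [->|_]; rewrite ?addn0.
have st_frame x : n <= x -> mem st x = mem s1 x.
  by move=> nx; rewrite /= s1_regs s2; have -> : (x == r) = false by lia.
have st_regs : [/\ regs st 0 = n, regs st 1 = regs s 1, regs st 2 = r,
    regs st 3 = regs s 3 - 1 & regs st 4 = n + k * n] by rewrite /= s1_regs.
have st_r : 0 < mem st r by rewrite st_cap eqxx addn1.
move: st st_out st_cap st_frame st_regs st_r => st st_out st_cap st_frame.
move=> [st0 st1 st2 st3 st4] st_r.
have nB : n <= regs st 4 by rewrite st4 leq_addr.
apply: wp_mono (wp_grow nB st0 st2 st_r st_out).
move=> t s' [tb [V' [par' [[gR gM gO gC gF] full]]]].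
apply/wp_seq/wp_assign/wp_assign => /=;
  rewrite !gR // st0 st1 st4; split; try lia.
do 3!eexists; apply: (packed_next Ps (V' := V') (par' := par')) => //=.
- by rewrite !gR // st0 st2 st3 mulSn; split=> //; lia.
- by move=> v; rewrite -gO st4.
- move=> v; rewrite gR // st3; have := gC v; rewrite st_cap.
  by case: eqP => [->|_]; lia.
- by move=> x nx xB; rewrite gF ?st4 // st_frame // s1_frame.
- by rewrite gR // st3; lia.
- case: full => [->|]; last by right.
  left; rewrite gR // st3 cardsT card_ord.
  by case: (regs s 3) s3 => // j _; rewrite subn1 mulSn.
Qed.

Lemma wp_pack n (r : 'I_n) (c : 'I_n -> nat) K :
  0 < K ->
  wp pack (fun t s => t <= 400 * (n * K) /\
             exists V par, packed r c K K s V par) (input_state K r c).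
Proof.
move=> K_gt0; have r_lt := ltn_ord r.
have memE (v : 'I_n) : mem (input_state K r c) v = c v by rewrite /= valK.
have memN x : n <= x -> mem (input_state K r c) x = 0.
  by move=> nx; rewrite /= insubF // ltnNge nx.
have sR : regs (input_state K r c) = nth 0 [:: n; K; val r] by [].
move: (input_state K r c) sR memE memN => s sR memE memN.
apply/wp_seq/wp_assign/wp_seq/wp_put/wp_seq/wp_assign.
rewrite /= sR /= !memE -minnE.
pose I s := exists k V par, packed r c K k s V par.
(* There are [K] rounds of cost at most [300 * n + 2], plus a constant set-up; positivity of [n] and
   [K] absorbs the rest into [400 * (n * K)]. *)
apply: (@wp_while _ _ I (fun s : state => regs s 1) (300 * n)).
- exists 0, (fun=> set0), (fun=> id); split=> //=.
  + by split; rewrite // ?addn0 // geq_minr.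
  + move=> v; rewrite big_ord0 addn0; have -> : (v == r :> nat) = (v == r) by [].
    by case: eqP => [->|_]; rewrite ?memE ?addn0 // mul1n subnK ?geq_minl.
  + by move=> x nx; have -> : (x == r) = false; [lia|rewrite memN //; lia].
  + by apply: Or32; rewrite big_ord0.
- move=> s2 [k [V [par Ps]]] /= K_left; apply: wp_mono (wp_next_tree Ps _) => //.
  by rewrite lt0n.
- move=> t s' /= tb [k [V [par Ps]]] s1; split.
    have nK1 : n <= n * K by apply: leq_pmulr.
    have nK2 : K <= n * K by apply: leq_pmull; apply: leq_ltn_trans r_lt.
    by nia.
  have [_ kK _ _ _] := packed_regs Ps; rewrite s1 add0n in kK.
  by exists V, par; rewrite -{2}kK.
Qed.

(** * Optimality of the computed packing *)

(** No unit is reserved at the end, so the last two cases of [packed_max] each attain one term of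
    the outer minimum; in the first case [n.-1] vanishes. *)
Lemma packed_value n (r : 'I_n) c K s V par :
  packed r c K K s V par -> regs s 1 = 0 ->
  K + minn (minn (c r) K * n.-1) (\sum_v c v) <= \sum_(k < K) #|V k|.
Proof.
move=> Ps s1; have [_ _ _ s3 _] := packed_regs Ps.
have {s1}s3 : regs s 3 = 0 by lia.
have VE : \sum_(k < K) #|V k| = K + \sum_(k < K) #|V k|.-1.
  rewrite -[X in X + _](card_ord K) -sum1_card -big_split /=.
  apply: eq_bigr => k _; rewrite add1n prednK //.
  by have [rV _ _] := packed_map Ps (ltn_ord k); apply/card_gt0P; exists r.
rewrite VE leq_add2l geq_min; case: (packed_max Ps) => [n1|<-|mem0].
- have n0 : n.-1 = 0 by lia.
  by rewrite n0 muln0 leq0n.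
- by rewrite s3 mul0n addn0 leqnn.
apply/orP; right; apply/eq_leq.
(* All capacity is spent, so every unit of [c] counts one child in some tree. *)
transitivity (\sum_v \sum_(k < K) kids r (V k) (par k) v).
  by apply: eq_bigr => v _; rewrite -(packed_cap Ps) mem0 s3 muln0.
rewrite exchange_big; apply: eq_bigr => k _ /=.
by have [rV _ _] := packed_map Ps (ltn_ord k); rewrite -(sum_kids (par k) rV).
Qed.

Theorem theorem2 :
  exists (p : cmd) (a : nat),
    forall (n : nat) (G : graph 'I_n) (r : 'I_n) (c : 'I_n -> nat) (K : nat),
      complete_graph G -> 0 < K ->
      exists (t : nat) (s : state) (T : 'I_K -> graph 'I_n),
        [/\ exec p (input_state K r c) t s,
            t <= a * (n * K),
            output_packing r T s
          & mbrtp_optimal G r c T].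
Proof.
exists pack, 400 => n G r c K cG K_gt0.
have [t [s [ex [tb [V [par Ps]]]]]] := wp_pack r c K_gt0.
have [_ s1K _ _ _] := packed_regs Ps.
have s1 : regs s 1 = 0 by lia.
have /fin_all_exists[T TP] (k : 'I_K) :=
  parent_map_graph cG (packed_map Ps (ltn_ord k)).
exists t, s, T; split=> //.
- move=> k; have [rtT vT childT] := TP k; split.
  + have [rV parr _] := packed_map Ps (ltn_ord k).
    by rewrite (packed_out Ps) // /parent_code rV parr.
  + by move=> v; rewrite vT (packed_out Ps) // /parent_code => /negPf ->.
  + move=> u v /childT[vV vr pv].
    by rewrite (packed_out Ps) // /parent_code vV pv.
- split.
    split; first by move=> k; case: (TP k).
    (* Each [nchildren] is at most the [kids] already charged to [v] in [packed_cap]. *)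
    move=> v _; rewrite -(packed_cap Ps v); apply: leq_trans (leq_addl _ _).
    apply: leq_sum => k _; apply/subset_leq_card/subsetP => w.
    by have [_ _ childT] := TP k; rewrite !inE => /childT[-> -> ->] /=.
  move=> T' /(packing_value_le cG) le_T'; apply: leq_trans le_T' _.
  rewrite card_ord; apply: leq_trans (packed_value Ps s1) _.
  by apply: leq_sum => k _; case: (TP k) => _ ->.
Qed.
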